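(* There exists an arrangement of $1$-floor boxes spanning two floors whose conflict graph has chromatic number $8$.
   Context: A box is a closed rectangular parallelepiped in $\mathbb{R}^3$ whose faces are parallel to the coordinate planes. A box arrangement is a finite collection of boxes with pairwise disjoint interiors. Its conflict graph has one vertex per box, and two boxes are adjacent when they are in face-to-face contact, that is, they share a portion of a wall, floor or ceiling of positive area. The chromatic number of an arrangement is the chromatic number of its conflict graph. The building is divided into floors, which are the horizontal slabs $\{(x,y,z): k\le z\le k+1\}$ for integers $k$. A box is $1$-floor if it lies within a single floor. An arrangement spans two floors if all its boxes lie within the union of two consecutive floors. *)

(* Defs.v *)
From mathcomp Require Import all_boot all_order all_algebra.
From mathcomp Require Import all_classical all_reals all_analysis.
Import Order.TTheory GRing.Theory Num.Theory.
Import numFieldNormedType.Exports.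

Set Implicit Arguments.
Unset Strict Implicit.
Unset Printing Implicit Defensive.

Local Open Scope classical_set_scope.
Local Open Scope ring_scope.

(** The coordinate of index [2 : 'I_3] is the vertical one. *)
Definition vert : 'I_3 := ord_max.

Record box (R : realType) := Box {
  lo : 'rV[R]_3;
  hi : 'rV[R]_3;
  lo_lt_hi : forall i, lo 0 i < hi 0 i }.

Definition box_set (R : realType) (b : box R) : set 'rV[R]_3 :=
  [set p | forall i, lo b 0 i <= p 0 i <= hi b 0 i].

Definition arrangement (R : realType) (n : nat) (A : 'I_n -> box R) : Prop :=
  trivIset [set: 'I_n] (fun j => interior (box_set (A j))).

(** The face of [b] orthogonal to axis [i], on the upper side when [s] is
    true and on the lower side otherwise. *)
Definition face (R : realType) (b : box R) (i : 'I_3) (s : bool) :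
    set 'rV[R]_3 :=
  [set p | box_set b p /\ p 0 i = (if s then hi b else lo b) 0 i].

(** [lift i] enumerates the two axes other than [i]. *)
Definition drop_axis (R : realType) (i : 'I_3) (p : 'rV[R]_3) : R * R :=
  (p 0 (lift i ord0), p 0 (lift i ord_max)).

(** Area of a set contained in a plane orthogonal to axis [i]: dropping the
    constant coordinate [i] is an isometry of that plane onto [R * R]. *)
Definition area (R : realType) (i : 'I_3) (S : set 'rV[R]_3) : \bar R :=
  (@lebesgue_measure R \x @lebesgue_measure R)%E (drop_axis i @` S).

Definition face_contact (R : realType) (b c : box R) : Prop :=
  exists (i : 'I_3) (s t : bool), (0 < area i (face b i s `&` face c i t))%E.

(** Distinctness is required because a box shares all its faces with
    itself. *)
Definition conflict (R : realType) (n : nat) (A : 'I_n -> box R) : rel 'I_n :=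
  fun j k => (j != k) && `[< face_contact (A j) (A k) >].

Definition colorable (T : finType) (e : rel T) (k : nat) : Prop :=
  exists f : T -> 'I_k, forall x y, e x y -> f x != f y.

Definition chromatic_number_is (T : finType) (e : rel T) (k : nat) : Prop :=
  colorable e k /\ forall m, colorable e m -> (k <= m)%N.

Definition floor_slab (R : realType) (k : int) : set 'rV[R]_3 :=
  [set p | k%:~R <= p 0 vert <= (k + 1)%:~R].

Definition one_floor (R : realType) (b : box R) : Prop :=
  exists k : int, box_set b `<=` @floor_slab R k.

Definition spans_two_floors (R : realType) (n : nat) (A : 'I_n -> box R) :
    Prop :=
  exists k : int, forall j,
    box_set (A j) `<=` @floor_slab R k `|` @floor_slab R (k + 1).

(* Main.v *)
(** The wheel with five spokes is not 3-colourable, and it is the contact graph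
    of six rectangles all of which are long in the same direction.  Fill the
    lower floor with wheels that are long in the x direction and the upper one
    with wheels that are long in the y direction, for many positions of the
    internal walls.  Given a colouring by 7 colours, let [U m g] be the set of
    colours of the upper rooms that cross the whole y-block [m] inside the
    x-block [g].  By the pigeonhole principle there are three y-blocks where
    [U] agrees on many x-blocks, and then three x-blocks where it takes a
    single value [L].  The upper wheel each of whose rooms crosses one of the
    three y-blocks shows that [L] has at least 4 colours.  The lower wheel in
    the first of these y-blocks, each of whose rooms crosses one of the three
    x-blocks, uses no colour of [L], so at least 4 colours are outside [L]:
    a contradiction.  Deleting boxes one at a time then brings the chromatic
    number down to exactly 8. *)

Require Import Defs.
From mathcomp Require Import all_boot all_order all_algebra.
From mathcomp Require Import all_classical all_reals all_analysis.
From mathcomp Require Import zify.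
Import Order.TTheory GRing.Theory Num.Theory.
Import numFieldNormedType.Exports.
Set Implicit Arguments.
Unset Strict Implicit.
Unset Printing Implicit Defensive.
Local Open Scope ring_scope.

(** * Separation and contact of boxes read off their coordinates *)

Lemma interior_separated (R : realType) (b c : box R) (i : 'I_3) :
  hi b 0 i <= lo c 0 i ->
  (interior (box_set b) `&` interior (box_set c) = set0)%classic.
Proof.
move=> bc; rewrite -subset0 => p [/= /nbhs_ballP[e e0 be]].
move=> /nbhs_singleton /(_ i)/andP[cp _].
(* Moving [p] by [e / 2] along axis [i] stays in [b], yet passes beyond [hi b]. *)
have /be/(_ i)/andP[_] : ball p e (p + (e / 2) *: delta_mx 0 i).
  split=> // j k; rewrite /ball /= !mxE ord1 eqxx /=.
  rewrite opprD addrA subrr sub0r normrN normrM ger0_norm ?divr_ge0 ?ltW//.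
  case: (k == i); rewrite ?normr1 ?mulr1 ?normr0 ?mulr0//.
  by rewrite ltr_pdivrMr// ltr_pMr// ltr1n.
rewrite !mxE !eqxx mulr1 leNgt => /negP; apply.
by rewrite (le_lt_trans (le_trans bc cp))// ltrDl divr_gt0.
Qed.

Lemma face_contact_overlap (R : realType) (b c : box R) (i : 'I_3) :
  hi b 0 i = lo c 0 i ->
  (forall j, j != i -> lo b 0 j < hi c 0 j /\ lo c 0 j < hi b 0 j) ->
  face_contact b c.
Proof.
move=> bc ov; exists i, true, false; rewrite /area.
(* [l] and [h] bound the rectangle in which the two faces meet. *)
pose l j := Num.max (lo b 0 j) (lo c 0 j).
pose h j := Num.min (hi b 0 j) (hi c 0 j).
have lh j : j != i -> l j < h j.
  move=> /ov[bj cj]; rewrite /l /h gt_max !lt_min.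
  by rewrite !lo_lt_hi bj cj.
have -> : (drop_axis i @` (face b i true `&` face c i false))%classic =
    (`[l (lift i ord0), h (lift i ord0)] `*`
     `[l (lift i ord_max), h (lift i ord_max)])%classic.
  apply/seteqP; split=> [_ [p [[bp _] [cp _]] <-]|[x y] [/= hx hy]].
    split; rewrite /= in_itv /= ge_max le_min.
      by have /andP[-> ->] := bp (lift i ord0); have /andP[-> ->] := cp (lift i ord0).
    by have /andP[-> ->] := bp (lift i ord_max); have /andP[-> ->] := cp (lift i ord_max).
  pose p : 'rV[R]_3 := \row_j
    if j == i then hi b 0 i else if j == lift i ord0 then x else y.
  have p0 : p 0 (lift i ord0) = x.
    by rewrite mxE eq_sym (negbTE (neq_lift _ _)) eqxx.
  have p1 : p 0 (lift i ord_max) = y.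
    by rewrite mxE eq_sym (negbTE (neq_lift _ _)) (inj_eq lift_inj).
  have pi : p 0 i = hi b 0 i by rewrite mxE eqxx.
  exists p; last by rewrite /drop_axis p0 p1.
  have pj j : j != i -> l j <= p 0 j <= h j.
    rewrite eq_sym => /unlift_some[k -> _].
    have [->|->] : k = ord0 \/ k = ord_max.
    - case: k => [[|[|k]] hk]//; [left|right]; exact: val_inj.
    - by rewrite p0; move: hx; rewrite in_itv.
    - by rewrite p1; move: hy; rewrite in_itv.
  split; (split=> [j|]; last by rewrite pi ?bc).
  - have [->|/pj] := eqVneq j i; first by rewrite pi lexx ltW// lo_lt_hi.
    by rewrite ge_max le_min => /andP[/andP[-> _] /andP[-> _]].
  - have [->|/pj] := eqVneq j i; first by rewrite pi bc lexx ltW// lo_lt_hi.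
    by rewrite ge_max le_min => /andP[/andP[_ ->] /andP[_ ->]].
rewrite product_measure1E ?measurable_itv//=.
rewrite !lebesgue_measure_itv /= !lte_fin !lh 1?eq_sym ?neq_lift//.
by rewrite -!EFinB -EFinM lte_fin mulr_gt0// subr_gt0 lh// eq_sym neq_lift.
Qed.


(** * Critical subarrangements and a pigeonhole principle *)

Lemma colorable_leq (T : finType) (e : rel T) (k m : nat) :
  (k <= m)%N -> colorable e k -> colorable e m.
Proof.
move=> km [f fP]; exists (fun x => widen_ord km (f x)) => x y /fP.
by apply: contraNN => /eqP/(congr1 val)/= fxy; apply/eqP/val_inj.
Qed.

(* The shortest initial segment of [B] that is not [k]-colourable becomes
   [k]-colourable when its last box is removed. *)
Lemma exact_chromatic_subarrangement (R : realType) (n k : nat)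
    (B : 'I_n -> box R) :
  ~ colorable (conflict B) k ->
  exists (m : nat) (h : 'I_m -> 'I_n), injective h /\
    chromatic_number_is (conflict (B \o h)) k.+1.
Proof.
move=> ncol.
pose bad m := `[< exists mn : (m <= n)%N,
  ~ colorable (conflict (B \o widen_ord mn)) k >].
have idw x : widen_ord (leqnn n) x = x by exact: val_inj.
have exbad : exists m, bad m.
  exists n; apply/asboolP; exists (leqnn n); case=> f fP; apply: ncol.
  exists f => x y /andP[xy /asboolP xyc]; apply: fP; rewrite /conflict xy /=.
  by apply/asboolP; rewrite !idw.
case: (ex_minnP exbad) => m /asboolP[mn mbad] mmin.
exists m, (widen_ord mn); split.
  by move=> x y /(congr1 val)/= xy; exact: val_inj.
split; last first.
  by move=> c cc; rewrite ltnNge; apply/negP => ck; apply: mbad;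
     exact: colorable_leq cc.
case: m mn mbad mmin => [|m] mn mbad mmin.
  by exists (fun=> ord0) => -[].
have [f fP] : colorable (conflict (B \o widen_ord (ltnW mn))) k.
  apply: contrapT => bm; have /mmin : bad m by apply/asboolP; exists (ltnW mn).
  by rewrite ltnn.
have liftw z : widen_ord mn (lift ord_max z) = widen_ord (ltnW mn) z.
  by apply: val_inj; rewrite /= /bump leqNgt ltn_ord.
(* Only the last box gets the extra colour [ord_max]. *)
pose g x := if unlift ord_max x is Some y
  then widen_ord (leqnSn k) (f y) else ord_max.
exists g => x y /andP[xy /asboolP xyc]; rewrite /g.
case: unliftP xy xyc => [x' ->|->]; case: unliftP => [y' ->|->].
- rewrite (inj_eq lift_inj) => xy' xyc.
  have : conflict (B \o widen_ord (ltnW mn)) x' y'.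
    rewrite /conflict xy' /=; apply/asboolP.
    by rewrite /= -!liftw.
  by move=> /fP; apply: contraNN => /eqP/(congr1 val)/= /val_inj ->.
- by move=> _ _; apply/eqP => /(congr1 val)/= fk; have := ltn_ord (f x'); rewrite fk ltnn.
- by move=> _ _; apply/eqP => /(congr1 val)/= fk; have := ltn_ord (f y'); rewrite -fk ltnn.
- by rewrite eqxx.
Qed.

Lemma pigeonhole3 (T : finType) (n : nat) (f : 'I_n -> T) :
  (2 * #|T| < n)%N ->
  exists i j k : 'I_n, [/\ (i < j)%N, (j < k)%N, f i = f j & f j = f k].
Proof.
move=> Tn.
have [c cP] : exists c, (2 < #|[pred i | f i == c]|)%N.
  apply/existsP; apply: contraTT Tn => /existsPn hc; rewrite -leqNgt.
  rewrite -[n in (n <= _)%N]card_ord -sum1_card (partition_big f predT)//=.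
  apply: (@leq_trans (\sum_(c : T) 2)%N); last by rewrite sum_nat_const mulnC.
  apply: leq_sum => c _; have := hc c; rewrite -leqNgt; apply: leq_trans.
  by rewrite sum1_card.
(* [enum] lists the fibre increasingly, so its first three entries serve. *)
pose s := enum [pred i | f i == c].
have ss : sorted ltn (map val s).
  rewrite (_ : s = [seq i <- enum 'I_n | f i == c]); last by rewrite enumT.
  apply: (subseq_sorted ltn_trans) (iota_ltn_sorted 0 n).
  by rewrite -val_enum_ord map_subseq// filter_subseq.
have sP i : i \in s -> f i = c by rewrite mem_enum inE => /eqP.
move: cP; rewrite cardE -/s; case: s ss sP => [|i [|j [|k s]]]//=.
move=> /and3P[ij jk _] sP _; exists i, j, k.
by rewrite !sP// !inE eqxx ?orbT.
Qed.

(** * Rooms and wheels *)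

Definition nat_box (R : realType) (l h : 'I_3 -> nat)
    (lh : forall i, (l i < h i)%N) : box R.
Proof.
by refine (@Box R (\row_i (l i)%:R) (\row_i (h i)%:R) _) => i;
   rewrite !mxE ltr_nat.
Defined.

(* [(s, (g, b, d), r)] is the room [r] of a wheel on the lower ([s = false]) or
   upper floor.  The wheel lies in the block [g] of its thin direction, and [b],
   [d] fix its inner walls: they are at the start of the blocks [b + 1] and
   [b + d + 2] of its long direction, up to one unit.  The six rooms are
<<
     | 0 |     1     |
     | 2 |  3  |  4  |
     |       5       |
>>
   and the hub is the room 3. *)
Definition room (n : nat) : finType :=
  (bool * ('I_n.+1 * 'I_n.+1 * 'I_n.+1) * 'I_6)%type.

(* The number of rows of the wheels [(g, b, d)] with a given [g]. *)
Definition block_width (n : nat) : nat := 3 * (n.+1 * n.+1).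

Definition cut1 (n b : nat) : nat := block_width n * b.+1.
Definition cut2 (n b d : nat) : nat := block_width n * (b + d).+2.
(** [(b + d).+2] is at most [n.+1.*2], so the second wall always lies inside the wheel. *)
Definition wheel_length (n : nat) : nat := block_width n * n.+1.*2.+1.

Definition row_of (r : nat) : nat := nth 0%N [:: 0; 0; 1; 1; 1; 2]%N r.

(** The wall between 0 and 1 is one unit beyond that between 2 and 3, so that the hub touches both 0
    and 1. *)
Definition long_lo (n b d r : nat) : nat :=
  nth 0%N [:: 0; (cut1 n b).+1; 0; cut1 n b; cut2 n b d; 0]%N r.

Definition long_hi (n b d r : nat) : nat :=
  nth 0%N [:: (cut1 n b).+1; wheel_length n; cut1 n b; cut2 n b d;
              wheel_length n; wheel_length n]%N r.

(** Digits [g], [b], [d] to base [n.+1] give each wheel of a floor its own three rows. *)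
Definition thin_lo (n g b d r : nat) : nat :=
  3 * ((g * n.+1 + b) * n.+1 + d) + row_of r.

(** As a number, [s] is both the height of the floor and the index of the long axis. *)
Definition room_lo (n : nat) (x : room n) (i : 'I_3) : nat :=
  let: (s, (g, b, d), r) := x in
  if i == 2 :> nat then s : nat
  else if i == s :> nat then long_lo n b d r else thin_lo n g b d r.

Definition room_hi (n : nat) (x : room n) (i : 'I_3) : nat :=
  let: (s, (g, b, d), r) := x in
  if i == 2 :> nat then s.+1
  else if i == s :> nat then long_hi n b d r else (thin_lo n g b d r).+1.

Lemma cuts_ltn (n : nat) (b d : 'I_n.+1) :
  [/\ (0 < cut1 n b)%N, ((cut1 n b).+1 < cut2 n b d)%N &
      (cut2 n b d < wheel_length n)%N].
Proof.
have w0 : (2 < block_width n)%N by rewrite /block_width; nia.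
have bn := ltn_ord b; have dn := ltn_ord d.
rewrite /cut1 /cut2 /wheel_length; set w := block_width n in w0 *.
split; first by nia.
  have : (w * b.+2 <= w * (b + d).+2)%N by rewrite leq_mul2l !ltnS leq_addr orbT.
  by rewrite !mulnS; lia.
by rewrite ltn_pmul2l; lia.
Qed.

Lemma room_lo_hi (n : nat) (x : room n) (i : 'I_3) :
  (room_lo x i < room_hi x i)%N.
Proof.
case: x => [[s [[g b] d]] r] /=; have [c0 c1 c2] := cuts_ltn b d.
do 2 (case: ifP => // _).
by case: r => [[|[|[|[|[|[|r]]]]]] //= hr]; rewrite /long_lo /long_hi /=; lia.
Qed.

Definition room_box (R : realType) (n : nat) (x : room n) : box R :=
  nat_box R (room_lo_hi x).

Lemma room_contact (R : realType) (n : nat) (x y : room n) (i : 'I_3) :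
  room_hi x i = room_lo y i ->
  (forall j, j != i ->
    (room_lo x j < room_hi y j)%N && (room_lo y j < room_hi x j)%N) ->
  face_contact (room_box R x) (room_box R y).
Proof.
move=> xy ov; apply: (@face_contact_overlap _ _ _ i); first by rewrite !mxE xy.
by move=> j /ov/andP[? ?]; rewrite !mxE !ltr_nat.
Qed.

(** Rim 0, 1, 4, 5, 2 around the hub 3; the first room of each pair is on the lower side of the
    shared wall. *)
Definition wheel_edge (r r' : nat) : bool :=
  (r, r') \in [:: (0, 1); (2, 3); (3, 4); (0, 2); (0, 3); (1, 3); (1, 4);
                  (2, 5); (3, 5); (4, 5)]%N.

Lemma wheel_contact (R : realType) (n : nat) (s : bool)
    (g : 'I_n.+1 * 'I_n.+1 * 'I_n.+1) (r r' : 'I_6) :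
  wheel_edge r r' -> face_contact (room_box R (s, g, r)) (room_box R (s, g, r')).
Proof.
case: g => [[g b] d] rr'; have [c0 c1 c2] := cuts_ltn b d.
pose i : 'I_3 := inord (if row_of r == row_of r' then s else ~~ s).
have iE : i = (if row_of r == row_of r' then s else ~~ s) :> nat.
  by rewrite inordK//; case: ifP; case: (s).
apply: (@room_contact _ _ _ _ i) => [|j].
  rewrite /room_lo /room_hi iE.
  by case: s {i iE}; case: r r' rr' => [[|[|[|[|[|[|r]]]]]] //= hr]
    [[|[|[|[|[|[|r']]]]]] //= hr'] //= _; rewrite /long_lo /thin_lo /row_of /=; lia.
rewrite -val_eqE /= iE /long_lo /long_hi /thin_lo.
by case: s {i iE}; case: j => [[|[|[|j]]] //= hj];
  case: r r' rr' => [[|[|[|[|[|[|r]]]]]] //= hr]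
    [[|[|[|[|[|[|r']]]]]] //= hr'] //= _; rewrite /row_of /=; lia.
Qed.

(** * Contacts between the floors, and disjointness of rooms *)

Definition covers (n b d r k : nat) : bool :=
  (long_lo n b d r <= block_width n * k)%N &&
  (block_width n * k.+1 <= long_hi n b d r)%N.

Lemma thin_block (n : nat) (g b d : 'I_n.+1) (r : 'I_6) :
  (block_width n * g <= thin_lo n g b d r < block_width n * g.+1)%N.
Proof.
have bn := ltn_ord b; have dn := ltn_ord d.
have r2 : (row_of r <= 2)%N by case: r => [[|[|[|[|[|[|r]]]]]] //= hr].
rewrite /thin_lo /block_width.
have : (b * n.+1 + d < n.+1 * n.+1)%N by nia.
nia.
Qed.

(** By [thin_block], the thin side of each room lies in the block that the other room crosses. *)
Lemma crossing_contact (R : realType) (n : nat)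
    (g b d g' b' d' : 'I_n.+1) (r r' : 'I_6) :
  covers n b d r g' -> covers n b' d' r' g ->
  face_contact (room_box R (false, (g, b, d), r))
               (room_box R (true, (g', b', d'), r')).
Proof.
move=> /andP[lo1 hi1] /andP[lo2 hi2].
have /andP[t1 t1'] := thin_block g b d r.
have /andP[t2 t2'] := thin_block g' b' d' r'.
apply: (@room_contact _ _ _ _ ord_max) => // j.
by case: j => [[|[|[|j]]] //= hj] _; lia.
Qed.

(** With walls at the starts of blocks [j] and [k], rooms 0 and 2 cross [i], the hub crosses [j],
    rooms 1 and 4 cross [k], and 5 crosses all. *)
Lemma covers_triple (n : nat) (i j k : 'I_n.+1) :
  (i < j)%N -> (j < k)%N ->
  exists b d : 'I_n.+1, forall r : 'I_6,
    [|| covers n b d r i, covers n b d r j | covers n b d r k].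
Proof.
move=> ij jk; have kn := ltn_ord k.
have bn : (j.-1 < n.+1)%N by lia.
have dn : (k - j.+1 < n.+1)%N by lia.
exists (Ordinal bn), (Ordinal dn) => r.
have w0 : (2 < block_width n)%N by rewrite /block_width; nia.
rewrite /covers /long_lo /long_hi /cut1 /cut2 /wheel_length /=.
rewrite (_ : j.-1.+1 = j); last by lia.
rewrite (_ : (j.-1 + (k - j.+1)).+2 = k); last by lia.
set w := block_width n in w0 *.
have ijw : (w * i.+1 <= w * j)%N by rewrite leq_mul2l ij orbT.
have jkw : (w * j.+1 <= w * k)%N by rewrite leq_mul2l jk orbT.
have kw : (w * k.+1 <= w * n.+1.*2.+1)%N by rewrite leq_mul2l; apply/orP; right; lia.
rewrite !mulnS in ijw jkw kw *.
case: r => [[|[|[|[|[|[|r]]]]]] //= hr]; lia.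
Qed.

Lemma wheel_code_inj (n : nat) (g b d g' b' d' : 'I_n.+1) :
  ((g * n.+1 + b) * n.+1 + d = (g' * n.+1 + b') * n.+1 + d')%N ->
  (g, b, d) = (g', b', d').
Proof.
have split_inj (q q' : nat) (r r' : 'I_n.+1) :
    (q * n.+1 + r = q' * n.+1 + r')%N -> q = q' /\ r = r'.
  move=> qr; have rr : r = r'.
    apply: val_inj; move: (congr1 (modn^~ n.+1) qr).
    by rewrite /= !modnMDl !modn_small.
  by move: qr; rewrite rr => /addIn/eqP; rewrite eqn_pmul2r// => /eqP.
by move=> /split_inj[/split_inj[/val_inj -> ->] ->].
Qed.

Lemma rooms_separated (n : nat) (x y : room n) : x != y ->
  exists i, (room_hi x i <= room_lo y i)%N || (room_hi y i <= room_lo x i)%N.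
Proof.
case: x y => [[s [[g b] d]] r] [[s' [[g' b'] d']] r'] xy.
have [ss'|ss'] := eqVneq s s'; last first.
  by exists ord_max => /=; case: s s' ss' {xy} => -[].
subst s'.
have [gg|gg] := eqVneq (g, b, d) (g', b', d'); last first.
  exists (inord (~~ s)); rewrite /room_lo /room_hi inordK; last by case: (s).
  have -> : (~~ s == s :> nat) = false by case: (s).
  have -> : (~~ s == 2 :> nat) = false by case: (s).
  have r2 (q : 'I_6) : (row_of q <= 2)%N by case: q => [[|[|[|[|[|[|q]]]]]] //= hq].
  have := r2 r; have := r2 r'; rewrite /thin_lo.
  have /eqP := contra_neq (@wheel_code_inj n g b d g' b' d') gg.
  by lia.
case: gg xy => -> -> -> xy {g b d}.
have rr : r != r' by apply: contraNneq xy => ->.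
have [c0 c1 c2] := cuts_ltn b' d'.
exists (inord (if row_of r == row_of r' then s else ~~ s)).
rewrite /room_lo /room_hi inordK; last by case: ifP; case: (s).
rewrite /thin_lo /long_lo /long_hi {xy}.
by case: s; case: r r' rr => [[|[|[|[|[|[|r]]]]]] //= hr]
    [[|[|[|[|[|[|r']]]]]] //= hr'] //= _; rewrite /row_of /=; lia.
Qed.

(** * Counting colours *)

Lemma wheel_colors (K : finType) (c : 'I_6 -> K) (S : {set K}) :
  (forall r r' : 'I_6, wheel_edge r r' -> c r != c r') ->
  (forall r, c r \in S) -> (3 < #|S|)%N.
Proof.
move=> cP cS; pose q (k : nat) := c (inord k).
have qP k k' : wheel_edge k k' -> q k != q k'.
  move=> kk'; apply: cP.
  by move: kk'; rewrite /wheel_edge !inE;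
    do 9 (case/orP => [/eqP[-> ->]|]; first by rewrite !inordK);
    move/eqP => [-> ->]; rewrite !inordK.
have subS k1 k2 k3 k4 : uniq [:: q k1; q k2; q k3; q k4] -> (3 < #|S|)%N.
  move=> u; rewrite cardE; apply: (uniq_leq_size u) => x.
  by rewrite mem_enum !inE => /or4P[] /eqP ->; exact: cS.
have e01 := qP 0%N 1%N isT; have e23 := qP 2%N 3%N isT.
have e34 := qP 3%N 4%N isT; have e02 := qP 0%N 2%N isT.
have e03 := qP 0%N 3%N isT; have e13 := qP 1%N 3%N isT.
have e14 := qP 1%N 4%N isT; have e25 := qP 2%N 5%N isT.
have e35 := qP 3%N 5%N isT; have e45 := qP 4%N 5%N isT.
(* If 1 agrees with 2 and 0 with 4, then 5 needs a colour besides those of 0, 1 and the hub. *)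
have [e12|e12] := eqVneq (q 1%N) (q 2%N); last first.
  by apply: (subS 0%N 1%N 2%N 3%N); rewrite /= !inE !negb_or e01 e02 e03 e12 e13 e23.
have [e04|e04] := eqVneq (q 0%N) (q 4%N); last first.
  by apply: (subS 0%N 1%N 3%N 4%N); rewrite /= !inE !negb_or e01 e03 e04 e13 e14 e34.
by apply: (subS 0%N 1%N 3%N 5%N); rewrite /= !inE !negb_or e01 e03 e04 e45 e13 e12 e25 e35.
Qed.

Lemma rooms_not_colorable (R : realType) (a n : nat) (f : room n -> 'I_7) :
  (2 * #|{set 'I_7}| < a)%N -> (a <= n.+1)%N ->
  (2 * #|{ffun 'I_a -> {set 'I_7}}| < n.+1)%N ->
  ~ (forall x y, x != y -> face_contact (room_box R x) (room_box R y) ->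
       f x != f y).
Proof.
move=> a_large an n_large fP.
pose U (m g : 'I_n.+1) : {set 'I_7} := [set k |
  [exists b : 'I_n.+1, exists d : 'I_n.+1, exists r : 'I_6,
    covers n b d r m && (f (true, (g, b, d), r) == k)]].
have wheelP s g (r r' : 'I_6) : wheel_edge r r' -> f (s, g, r) != f (s, g, r').
  move=> rr'; apply: fP; last exact: wheel_contact.
  by apply: contraTneq rr' => -[->]; case: r' => [[|[|[|[|[|[|r']]]]]] //= hr].
(* Only [a] x-blocks are recorded, so the number of possible values is independent of [n]. *)
pose V m := [ffun i : 'I_a => U m (widen_ord an i)].
have [m1 [m2 [m3 [m12 m23 V12 V23]]]] := @pigeonhole3 _ _ V n_large.
have [i1 [i2 [i3 [i12 i23 L12 L23]]]] := @pigeonhole3 _ _ (V m1) a_large.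
rewrite !ffunE in L12 L23.
set x1 := widen_ord an i1 in L12; set x2 := widen_ord an i2 in L12 L23.
set x3 := widen_ord an i3 in L23.
have U2 : U m2 x1 = U m1 x1 by move: V12 => /ffunP/(_ i1); rewrite !ffunE => ->.
have U3 : U m3 x1 = U m1 x1.
  by rewrite -U2; move: V23 => /ffunP/(_ i1); rewrite !ffunE => ->.
have [b' [d' upper]] := covers_triple m12 m23.
have [b [d lower]] := @covers_triple n x1 x2 x3 i12 i23.
have : (3 < #|U m1 x1|)%N.
  apply: (wheel_colors (c := fun r => f (true, (x1, b', d'), r))) => [|r].
    exact: wheelP.
  have inU (m : 'I_n.+1) : covers n b' d' r m -> f (true, (x1, b', d'), r) \in U m x1.
    move=> cm; rewrite inE; apply/existsP; exists b'; apply/existsP; exists d'.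
    by apply/existsP; exists r; rewrite cm eqxx.
  by have /or3P[/inU|/inU|/inU] := upper r; rewrite ?U2 ?U3.
have : (3 < #|~: U m1 x1|)%N.
  apply: (wheel_colors (c := fun r => f (false, (m1, b, d), r))) => [|r].
    exact: wheelP.
  rewrite inE.
  have notU (g : 'I_n.+1) : covers n b d r g -> f (false, (m1, b, d), r) \notin U m1 g.
    move=> cg; rewrite inE; apply/negP.
    move=> /existsP[b0 /existsP[d0 /existsP[r0 /andP[cm /eqP e]]]].
    (* The upper room with this colour lies in x-block [g] and crosses [m1], so it touches the lower
       room. *)
    have /(_ isT) := fun xy => fP _ _ xy (crossing_contact R cg cm).
    by rewrite e eqxx.
  by have /or3P[/notU|/notU|/notU] := lower r; rewrite -?L23 -?L12.
by have := cardsC (U m1 x1); rewrite card_ord; lia.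
Qed.

Theorem theorem1 (R : realType) :
  exists (n : nat) (A : 'I_n -> box R),
    [/\ arrangement A,
        forall j : 'I_n, one_floor (A j),
        spans_two_floors A
      & chromatic_number_is (conflict A) 8].
Proof.
(* Each pigeonhole needs more than twice as many blocks as values. *)
pose a := (2 * #|{set 'I_7}|).+1.
pose n := (2 * #|{ffun 'I_a -> {set 'I_7}}| + a)%N.
pose B (j : 'I_#|room n|) := room_box R (enum_val j).
have ncol : ~ colorable (conflict B) 7.
  move=> [f fP].
  apply: (@rooms_not_colorable R a n (fun x => f (enum_rank x))).
  - exact: ltnSn.
  - by rewrite /n leqW// leq_addl.
  - by rewrite /n ltnS leq_addr.
  - move=> x y xy xyc; apply: fP; rewrite /conflict (inj_eq enum_rank_inj) xy /=.
    by apply/asboolP; rewrite /B !enum_rankK.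
have [m [h [h_inj chi]]] := exact_chromatic_subarrangement ncol.
have floorP x p : box_set (room_box R x) p ->
    (x.1.1 : nat)%:R <= p 0 vert <= (x.1.1 : nat).+1%:R.
  by move=> /(_ vert); rewrite !mxE; case: x => [[s [[? ?] ?]] ?].
exists m, (B \o h); split => //.
- apply/trivIsetP => i j _ _ ij /=.
  have : enum_val (h i) != enum_val (h j).
    by rewrite (inj_eq enum_val_inj) (inj_eq h_inj).
  move=> /rooms_separated[k /orP[] kP].
    by apply: (@interior_separated _ _ _ k); rewrite !mxE ler_nat.
  by rewrite setIC; apply: (@interior_separated _ _ _ k); rewrite !mxE ler_nat.
- move=> j; exists ((enum_val (h j)).1.1 : nat) => p /floorP.
  by rewrite /floor_slab /= -PoszD addn1 -!pmulrn.
- exists 0 => j p /floorP; rewrite /floor_slab /=.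
  by case: (enum_val (h j)).1.1 => /=; [right|left].
Qed.
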